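(* Let $H$ be a Hilbert space, let $Q\in\mathbb{B}(H)$ be an idempotent and let $P_0\in\mathbb{B}(H)$ be a projection such that $\|P_0-Q\|$ is the minimum operator distance from $Q$ to all projections on $H$, i.e. $\|P_0-Q\|\le\|P-Q\|$ for every projection $P\in\mathbb{B}(H)$. Then $$\|I-P_0-Q\|=1+\|P_0-Q\|,$$ and this is the maximum operator distance from $Q$ to all projections on $H$, i.e. $\|P-Q\|\le \|I-P_0-Q\|$ for every projection $P\in\mathbb{B}(H)$.
   Context: $H$ is a non-zero complex Hilbert space, $\mathbb{B}(H)$ is the algebra of bounded linear operators on $H$ with the operator norm, and $I$ is the identity operator. An idempotent is $Q\in\mathbb{B}(H)$ with $Q^2=Q$; a projection is a self-adjoint idempotent. *)

(* Defs.v *)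
From HB Require Import structures.
From mathcomp Require Import all_boot all_order all_algebra.
From mathcomp Require Import complex.
From mathcomp Require Import all_classical all_reals all_analysis.
Set Implicit Arguments.
Unset Strict Implicit.
Unset Printing Implicit Defensive.
Import Order.TTheory GRing.Theory Num.Theory.
Import numFieldNormedType.Exports.
Local Open Scope classical_set_scope.
Local Open Scope ring_scope.

Section BoundedOperators.
Context {R : realType} {H : completeNormedModType R[i]}.

(* A complex Hilbert space is a Banach space H over R[i] together with an
   inner product (linear in the first argument) that induces its norm. *)
Definition induces_norm (dot : {dot H for Num.conj}) : Prop :=
  forall x : H, `|x| ^+ 2 = dot x x.

(* For a linear map this is equivalent to continuity and to
   `|T x| <= M * `|x| for some M: see linear_bounded_continuous and
   linear_boundedP. *)
Definition bounded_operator (T : {linear H -> H}) : Prop :=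
  bounded_near T (nbhs (0 : H)).

(* The norm of H takes its values in R[i]; they are real, and complex.Re
   brings them back to R, where suprema exist.  Like sup, the value is
   meaningful only when T is bounded on the unit ball. *)
Definition opnorm (T : H -> H) : R :=
  sup [set complex.Re `|T x| | x in [set x : H | `|x| <= 1]].

Definition idempotent_operator (Q : {linear H -> H}) : Prop :=
  bounded_operator Q /\ Q \o Q =1 Q.

Definition is_adjoint (dot : {dot H for Num.conj}) (T S : H -> H) : Prop :=
  forall x y : H, dot (T x) y = dot x (S y).

Definition projection (dot : {dot H for Num.conj}) (P : {linear H -> H}) : Prop :=
  idempotent_operator P /\ is_adjoint dot P P.

End BoundedOperators.

(* Main.v *)
Require Import Defs.
From HB Require Import structures.
From mathcomp Require Import all_boot all_order all_algebra.
From mathcomp Require Import complex.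
From mathcomp Require Import all_classical all_reals all_analysis.
From mathcomp Require Import ring lra.
Import Order.TTheory GRing.Theory Num.Theory.
Import numFieldNormedType.Exports.
Local Open Scope ring_scope.
Set Implicit Arguments.
Unset Strict Implicit.
Unset Printing Implicit Defensive.

(* Put d = |P0 - Q| and S = 2 Q - I.  Two projections are at distance at most
   1 and I - 2 P0 is isometric, so both |P - Q| <= 1 + d and
   |I - P0 - Q| <= 1 + d are triangle inequalities.  Conversely
   |I - P0 - Q| >= |S| - d, so it is enough that |S| >= 1 + 2 d, and for this
   to exhibit one projection P with |P - Q| <= (|S| - 1) / 2.  Since S is an
   involution, its unitary polar factor U is a self-adjoint involution, and
   P = (I + U) / 2 works: |U - S| = |I - sqrt(S S^* )| <= |S| - 1, because the
   spectrum of S S^* lies in [|S|^-2, |S|^2]. *)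

(** * The real-valued norm and convergence at a geometric rate *)

Section RealNorm.
Context {R : realType} {H : completeNormedModType R[i]}.
Implicit Types (x y z : H) (T : {linear H -> H}).

Definition rnorm x : R := complex.Re `|x|.

Lemma rnormE x : `|x| = (rnorm x)%:C%C.
Proof. by rewrite /rnorm RRe_real// normr_real. Qed.

Lemma rnorm_ge0 x : 0 <= rnorm x.
Proof. by rewrite -lecR -rnormE; exact: normr_ge0. Qed.

Lemma rnorm0 : rnorm 0 = 0.
Proof. by rewrite /rnorm normr0. Qed.

Lemma rnorm_le0 x : rnorm x <= 0 -> x = 0.
Proof. by rewrite -lecR -rnormE rmorph0 normr_le0 => /eqP. Qed.

Lemma rnorm_gt0 x : x != 0 -> 0 < rnorm x.
Proof. by rewrite -normr_gt0 rnormE ltcR. Qed.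

Lemma rnormD x y : rnorm (x + y) <= rnorm x + rnorm y.
Proof. by rewrite -lecR rmorphD/= -!rnormE ler_normD. Qed.

Lemma rnormN x : rnorm (- x) = rnorm x.
Proof. by rewrite /rnorm normrN. Qed.

Lemma rnormZ (a : R) x : rnorm (a%:C%C *: x) = `|a| * rnorm x.
Proof.
by apply: complexI; rewrite rmorphM/= -!rnormE normrZ normc_def/= expr0n/= addr0 sqrtr_sqr.
Qed.

Lemma rnorm_cauchy_cvg (u : nat -> H) :
  (forall e : R, 0 < e -> exists N, forall n m, (N <= n <= m)%N ->
     rnorm (u m - u n) < e) ->
  exists l, forall e : R, 0 < e -> exists N, forall n, (N <= n)%N ->
     rnorm (u n - l) < e.
Proof.
move=> uc.
have : cvgn u.
  apply/cauchy_cvgP/cauchy_exP => e e0 /=.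
  have ee : e = (complex.Re e)%:C%C by rewrite RRe_real ?gtr0_real.
  have [|N uN] := uc (complex.Re e); first by rewrite -ltcR -ee.
  exists (u N); exists N => //= n Nn.
  by rewrite -ball_normE/= distrC ee rnormE ltcR uN// leqnn.
move=> /cvgrPdistC_lt ul.
exists (limn u) => e e0.
have [|N _ uN] := ul e%:C%C; first by rewrite ltcR.
by exists N => n /uN; rewrite rnormE ltcR.
Qed.

Lemma expr_lt_eventually (q e : R) : 0 <= q < 1 -> 0 < e ->
  exists n, q ^+ n < e.
Proof.
move=> /andP[q0 q1] e0.
have /cvgrPdist_lt/(_ e e0)[N _ /(_ N (leqnn N))] :
    (q ^+ n @[n --> \oo] --> (0 : R))%classic.
  by apply: cvg_expr; rewrite ger0_norm.
by rewrite sub0r normrN normrX ger0_norm// => ?; exists N.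
Qed.

(** Summing the geometric tail gives the factor [K / (1 - q)]. The rate is kept explicit so that
    later limits can be handled by estimates valid for every [n]. *)
Lemma geometric_limit (u : nat -> H) (q K : R) : 0 <= q < 1 ->
    (forall n, rnorm (u n.+1 - u n) <= K * q ^+ n) ->
  exists l, forall n, rnorm (u n - l) <= K / (1 - q) * q ^+ n.
Proof.
move=> q01 uK; have /andP[q0 q1] := q01.
have K0 : 0 <= K by apply: le_trans (rnorm_ge0 _) (le_trans (uK 0%N) _); rewrite expr0 mulr1.
have C0 : 0 <= K / (1 - q) by rewrite divr_ge0// subr_ge0 ltW.
have uC n k : rnorm (u (n + k)%N - u n) <= K / (1 - q) * q ^+ n.
  (* The exact partial sum of the geometric series, unlike its bound, is stable under induction on
     [k]. *)
  apply: (@le_trans _ _ (K / (1 - q) * (q ^+ n - q ^+ (n + k)))); last first.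
    by rewrite ler_wpM2l// gerBl exprn_ge0.
  elim: k => [|k IH]; first by rewrite addn0 !subrr rnorm0 mulr0.
  rewrite addnS -(subrKA (u (n + k)%N)) (le_trans (rnormD _ _))//.
  apply: le_trans (lerD (uK _) IH) _.
  rewrite le_eqVlt; apply/orP; left; apply/eqP; rewrite exprS; field.
  by rewrite subr_eq0 gt_eqF.
have [|l ul] := @rnorm_cauchy_cvg u.
  move=> e e0.
  (* Adding 1 keeps the divisor positive when [K = 0]. *)
  have C1 : 0 < K / (1 - q) + 1 by rewrite ltr_wpDl.
  have [|N qN] := @expr_lt_eventually q (e / (K / (1 - q) + 1)) q01.
    by rewrite divr_gt0.
  exists N => n m /andP[Nn nm]; rewrite -(subnKC nm).
  apply: le_lt_trans (uC _ _) _.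
  rewrite ltr_pdivlMr// in qN; apply: le_lt_trans qN.
  rewrite mulrC ler_pM ?exprn_ge0 ?lerDl//.
  by rewrite ler_wiXn2l// ltW.
exists l => n; apply/ler_addgt0Pr => e e0.
have [N uN] := ul e e0.
rewrite -(subrKA (u (n + N)%N)) (le_trans (rnormD _ _))// lerD//.
  by rewrite -rnormN opprB uC.
by rewrite ltW// uN// leq_addl.
Qed.

(** Stands in for passing to the limit: a defect below [K * q ^+ n] for every [n] vanishes. *)
Lemma le0_geometric (q K a : R) : 0 <= q < 1 ->
  (forall n, a <= K * q ^+ n) -> a <= 0.
Proof.
move=> q01 aK; apply/ler_addgt0Pr => e e0; rewrite add0r.
have [K0|K0] := leP K 0.
  by apply: le_trans (aK 0%N) _; rewrite expr0 mulr1; exact: le_trans (ltW e0).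
have [|n qn] := @expr_lt_eventually q (e / K) q01; first by rewrite divr_gt0.
by apply: le_trans (aK n) _; rewrite mulrC -ler_pdivlMr// ltW.
Qed.

Lemma eq_geometric (q K : R) x y : 0 <= q < 1 ->
  (forall n, rnorm (x - y) <= K * q ^+ n) -> x = y.
Proof.
by move=> q01 /(le0_geometric q01)/rnorm_le0/eqP; rewrite subr_eq0 => /eqP.
Qed.

End RealNorm.

(** * The real inner product: Riesz representation, adjoints, norms of symmetric operators *)

Section RealDot.
Context {R : realType} {H : completeNormedModType R[i]}.
Variable dot : {dot H for Num.conj}.
Hypothesis dot_norm : induces_norm dot.
Implicit Types (x y z : H) (T : {linear H -> H}).

Definition rdot x y : R := complex.Re (dot x y).

Lemma rdotDl x y z : rdot (x + y) z = rdot x z + rdot y z.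
Proof. by rewrite /rdot linearDl raddfD. Qed.

Lemma rdotC x y : rdot x y = rdot y x.
Proof.
by rewrite /rdot (@hermC _ _ _ _ dot) expr0 mul1r/=; case: (dot y x) => a b.
Qed.

Lemma rdotDr x y z : rdot x (y + z) = rdot x y + rdot x z.
Proof. by rewrite rdotC rdotDl !(rdotC x). Qed.

Lemma rdotZl (a : R) x y : rdot (a%:C%C *: x) y = a * rdot x y.
Proof.
by rewrite /rdot linearZl_LR/=; case: (dot x y) => b c /=; rewrite mul0r subr0.
Qed.

Lemma rdotZr (a : R) x y : rdot x (a%:C%C *: y) = a * rdot x y.
Proof. by rewrite rdotC rdotZl rdotC. Qed.

Lemma rdotNl x y : rdot (- x) y = - rdot x y.
Proof. by rewrite /rdot linearNl raddfN. Qed.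

Lemma rdotNr x y : rdot x (- y) = - rdot x y.
Proof. by rewrite rdotC rdotNl rdotC. Qed.

(** Retains enough of the complex structure for adjoints with respect to [rdot] to be complex
    linear. *)
Lemma rdotZCl (a : R[i]) x y : rdot (a *: x) y = rdot x (a^* *: y).
Proof. by rewrite /rdot linearZl_LR linearZr_LR/= conjCK. Qed.

Definition rdotE := (rdotDl, rdotDr, rdotNl, rdotNr, rdotZl, rdotZr).

Lemma rdotxx x : rdot x x = rnorm x ^+ 2.
Proof. by rewrite /rdot -dot_norm rnormE -rmorphXn. Qed.

Lemma rdot_le x y : rdot x y <= rnorm x * rnorm y.
Proof.
have [->|x0] := eqVneq x 0.
  by rewrite rnorm0 mul0r -[0 in X in X <= _](scale0r (0 : H)) (rdotZl 0) mul0r.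
have [->|y0] := eqVneq y 0.
  by rewrite rnorm0 mulr0 rdotC -[0 in X in X <= _](scale0r (0 : H)) (rdotZl 0) mul0r.
have nx := rnorm_gt0 x0; have ny := rnorm_gt0 y0.
(* With a = |x| and b = |y|, this square expands to 2ab(ab - [rdot x y]). *)
have := sqr_ge0 (rnorm ((rnorm y)%:C%C *: x - (rnorm x)%:C%C *: y)).
rewrite -rdotxx !rdotE !rdotxx (rdotC y x) => h.
rewrite -(ler_pM2l (mulr_gt0 nx ny)); nra.
Qed.

Lemma rdot_ext x y : (forall z, rdot z x = rdot z y) -> x = y.
Proof.
move=> xy; have : rnorm (x - y) ^+ 2 = 0.
  by rewrite -rdotxx rdotDr rdotNr xy subrr.
move/eqP; rewrite sqrf_eq0 => /eqP n0.
by apply/eqP; rewrite -subr_eq0; apply/eqP/rnorm_le0; rewrite n0.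
Qed.

(** The representing vector is the minimiser of [F x], that is |x|^2 - 2 f(x), reached as the limit
    of a minimising sequence. *)
Lemma riesz (f : H -> R) (M : R) :
    (forall x y, f (x + y) = f x + f y) ->
    (forall (a : R) x, f (a%:C%C *: x) = a * f x) ->
    (forall x, f x <= M * rnorm x) ->
  exists z, forall x, f x = rdot x z.
Proof.
move=> fD fZ fM.
pose F x := rdot x x - 2 * f x.
have Flb : has_lbound (range F).
  (* Completing the square: |x|^2 - 2M|x| >= -M^2. *)
  exists (- M ^+ 2) => _ [x _ <-]; rewrite /F rdotxx.
  have := fM x; have := sqr_ge0 (rnorm x - M); nra.
have Fne : (range F !=set0)%classic by exists (F 0), 0.
set m := inf (range F).
have mF x : m <= F x by apply: ge_inf => //; exists x.
have q01 : 0 <= (2^-1 : R) < 1 by lra.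
have qn0 n : 0 < (2^-1 : R) ^+ n by rewrite exprn_gt0// invr_gt0.
have /choice[u uF] n : exists x, F x <= m + ((2^-1 : R) ^+ n) ^+ 2.
  have [_ [x _ <-] /ltW ?] := inf_adherent (exprn_gt0 2 (qn0 n)) (conj Fne Flb).
  by exists x.
have [n|l ul] := @geometric_limit _ _ u 2^-1 2 q01.
  (* Parallelogram law: |a - b|^2 = 2 F(a) + 2 F(b) - 4 F((a + b) / 2), so near-minimisers are close
     to each other. *)
  have := mF ((2^-1)%:C%C *: (u n.+1 + u n)).
  have := uF n; have := uF n.+1; rewrite (exprS _ n).
  set q := 2^-1 ^+ n; have : 0 < q := qn0 n.
  rewrite /F fZ fD !rdotE (rdotC (u n)) => q0 h1 h2 h3.
  rewrite -(ler_pXn2r (n := 2))// ?nnegrE ?rnorm_ge0//; last by rewrite mulr_ge0// ltW.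
  by rewrite -rdotxx !rdotE (rdotC (u n)); nra.
exists l => h.
have key n : `|rdot (u n) h - f h| <= (1 + rnorm h ^+ 2) * 2^-1 ^+ n.
  set q := _ ^+ n; have q0 : 0 < q := qn0 n.
  (* Moving [u n] by q h or -q h cannot lower [F] by more than q^2; dividing by q bounds the linear
     term from both sides. *)
  have := mF (u n + q%:C%C *: h); have := mF (u n + (- q)%:C%C *: h).
  have := uF n; rewrite -/q.
  have k0 : 0 <= q ^+ 2 * (1 + rdot h h).
    by rewrite rdotxx mulr_ge0 ?sqr_ge0// addr_ge0 ?sqr_ge0.
  rewrite /F !fD !fZ !rdotE (rdotC h (u n)) -rdotxx => h1 h2 h3.
  by rewrite ler_norml; apply/andP; split; rewrite -(ler_pM2l q0); lra.
have : `|rdot l h - f h| <= 0.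
  apply: (@le0_geometric _ _ ((1 + rnorm h ^+ 2) + 4 * rnorm h) _ q01) => n.
  have -> : rdot l h - f h = (rdot (u n) h - f h) - rdot (u n - l) h.
    by rewrite rdotE rdotNl; ring.
  rewrite mulrDl (le_trans (ler_normB _ _))// lerD// ?key//.
  have : `|rdot (u n - l) h| <= rnorm (u n - l) * rnorm h.
    by rewrite ler_norml lerNl -rdotNl rdot_le -(rnormN (_ - _)) rdot_le.
  move/le_trans; apply; rewrite mulrAC ler_wpM2r ?rnorm_ge0//.
  by apply: le_trans (ul n) _; rewrite ler_wpM2r ?(ltW (qn0 n))// ler_pdivrMr; lra.
by rewrite normr_le0 subr_eq0 rdotC => /eqP.
Qed.

Lemma linear_pack (f : H -> H) : linear f ->
  exists T : {linear H -> H}, forall x, T x = f x.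
Proof.
move=> lf; pose m := GRing.isLinear.Build _ _ _ _ f lf.
by exists (HB.pack_for {linear H -> H} f m).
Qed.

(** Riesz applied, for each [y], to the functional [rdot (T x) y] of [x]. *)
Lemma adjoint_ex T (M : R) : (forall x, rnorm (T x) <= M * rnorm x) ->
  exists T' : {linear H -> H}, forall x y, rdot (T x) y = rdot x (T' y).
Proof.
move=> TM.
have /choice[f Tf] y : exists z, forall x, rdot (T x) y = rdot x z.
  apply: (@riesz (fun x => rdot (T x) y) (M * rnorm y)).
  - by move=> x z; rewrite linearD rdotDl.
  - by move=> a x; rewrite linearZ rdotZl.
  - move=> x; rewrite mulrAC (le_trans (rdot_le _ _))//.
    by rewrite ler_wpM2r ?rnorm_ge0.
have [|T' T'E] := @linear_pack f.
  move=> a x y; apply: rdot_ext => z.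
  by rewrite -Tf !rdotDr -[a]conjCK -!rdotZCl -linearZ !Tf.
by exists T' => x y; rewrite T'E Tf.
Qed.

Lemma adjoint_bound T (T' : H -> H) (M : R) : 0 <= M ->
    (forall x, rnorm (T x) <= M * rnorm x) ->
    (forall x y, rdot (T x) y = rdot x (T' y)) ->
  forall x, rnorm (T' x) <= M * rnorm x.
Proof.
move=> M0 TM TT' x.
have [->|nz] := eqVneq (T' x) 0; first by rewrite rnorm0 mulr_ge0 ?rnorm_ge0.
rewrite -(ler_pM2l (rnorm_gt0 nz)) -expr2 -rdotxx -TT' mulrCA mulrA.
by rewrite (le_trans (rdot_le _ _))// ler_wpM2r ?rnorm_ge0.
Qed.

(** Polarisation: for [y] along [T x] with |y| = |x|, the forms at x + y and x - y differ by
    4|x||Tx|, while the parallelogram law bounds the difference by 4a|x|^2. *)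
Lemma symmetric_form_bound T (a : R) : 0 <= a ->
    (forall x y, rdot (T x) y = rdot x (T y)) ->
    (forall x, `|rdot (T x) x| <= a * rnorm x ^+ 2) ->
  forall x, rnorm (T x) <= a * rnorm x.
Proof.
move=> a0 Ts Ta x.
have [->|Tx0] := eqVneq (T x) 0; first by rewrite rnorm0 mulr_ge0 ?rnorm_ge0.
have tx := rnorm_gt0 Tx0.
have [x0|x0] := eqVneq x 0; first by move: Tx0; rewrite x0 linear0 eqxx.
have nx := rnorm_gt0 x0.
have [y ny Txy] : exists2 y, rnorm y = rnorm x & rdot (T x) y = rnorm x * rnorm (T x).
  exists ((rnorm x / rnorm (T x))%:C%C *: T x).
    by rewrite rnormZ ger0_norm ?divr_ge0 ?rnorm_ge0// divfK// gt_eqF.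
  by rewrite rdotZr rdotxx; field; rewrite gt_eqF.
have Tyx : rdot (T y) x = rnorm x * rnorm (T x) by rewrite Ts rdotC.
have := Ta (x + y); have := Ta (x - y).
rewrite !ler_norml -!rdotxx linearB linearD !rdotE !rdotxx ny (rdotC y x) Txy Tyx.
move=> /andP[h1 h2] /andP[h3 h4].
by rewrite -(ler_pM2l nx); nra.
Qed.

End RealDot.

(** * The square root iteration and its limit *)

Section SquareRoot.
Context {R : realType} {H : completeNormedModType R[i]}.
Implicit Types (x y z : H).

(* The iteration X <- (G + X^2) / 2, whose fixed point is 1 - sqrt (1 - G). *)
Fixpoint sqrt_iter (G : H -> H) (n : nat) : H -> H :=
  if n is n'.+1 then
    fun x => (2^-1)%:C%C *: (G x + sqrt_iter G n' (sqrt_iter G n' x))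
  else fun=> 0.

Lemma sqrt_iter_linear (G : {linear H -> H}) n : linear (sqrt_iter G n).
Proof.
elim: n => [|n IH] a x y /=; first by rewrite scaler0 addr0.
rewrite linearP !IH [in RHS]scalerA [a * _]mulrC -[in RHS]scalerA -scalerDr.
by congr (_ *: _); rewrite scalerDr addrACA.
Qed.

Lemma sqrt_iterB (G : {linear H -> H}) n x y :
  sqrt_iter G n (x - y) = sqrt_iter G n x - sqrt_iter G n y.
Proof. by rewrite addrC -scaleN1r sqrt_iter_linear scaleN1r addrC. Qed.

Lemma sqrt_iter_intertwine (L G G' : {linear H -> H}) n :
    (forall x, L (G x) = G' (L x)) ->
  forall x, L (sqrt_iter G n x) = sqrt_iter G' n (L x).
Proof.
move=> LG; elim: n => [|n IH] x /=; first by rewrite linear0.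
by rewrite linearZ linearD LG !IH.
Qed.

Section Convergence.
Variables (G : {linear H -> H}) (q : R).
Hypothesis q01 : 0 <= q < 1.
Hypothesis Gq : forall x, rnorm (G x) <= (2 * q - q ^+ 2) * rnorm x.

(** The bound on [G] makes [q] invariant: a bound [q] on X gives (2q - q^2 + q^2) / 2 = q for (G +
    X^2) / 2. *)
Lemma sqrt_iter_bound n x : rnorm (sqrt_iter G n x) <= q * rnorm x.
Proof.
have /andP[q0 _] := q01.
elim: n x => [|n IH] x /=; first by rewrite rnorm0 mulr_ge0 ?rnorm_ge0.
rewrite rnormZ ger0_norm ?invr_ge0// ler_pdivrMl//.
apply: le_trans (rnormD _ _) _.
have := ler_wpM2l q0 (IH x); have := IH (sqrt_iter G n x); have := Gq x.
nra.
Qed.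

Lemma sqrt_iter_step n x :
  rnorm (sqrt_iter G n.+1 x - sqrt_iter G n x) <= q * rnorm x * q ^+ n.
Proof.
have /andP[q0 _] := q01.
elim: n x => [|n IH] x.
  by rewrite subr0 expr0 mulr1 sqrt_iter_bound.
set X := sqrt_iter G n; set Y := sqrt_iter G n.+1.
(* Y^2 - X^2 = Y(Y - X) + (Y - X)X; each term gains a factor [q], and the half absorbs their
   number. *)
have -> : sqrt_iter G n.+2 x - Y x =
    (2^-1)%:C%C *: (Y (Y x - X x) + (Y (X x) - X (X x))).
  rewrite -[LHS]/((2^-1)%:C%C *: (G x + Y (Y x)) -
    (2^-1)%:C%C *: (G x + X (X x))) -scalerBr.
  have -> : Y (Y x - X x) = Y (Y x) - Y (X x) := sqrt_iterB _ _ _ _.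
  by rewrite subrKA opprD addrACA subrr add0r.
rewrite rnormZ ger0_norm ?invr_ge0// ler_pdivrMl// (exprS _ n).
apply: le_trans (rnormD _ _) _.
have := sqrt_iter_bound n.+1 (Y x - X x); have := IH (X x).
have := ler_wpM2l q0 (IH x); rewrite -/X -/Y.
have := ler_wpM2r (exprn_ge0 n q0) (ler_wpM2l q0 (sqrt_iter_bound n x)).
rewrite -/X; nra.
Qed.

Lemma sqrt_iter_lim : exists X : {linear H -> H}, forall x n,
  rnorm (sqrt_iter G n x - X x) <= q / (1 - q) * rnorm x * q ^+ n.
Proof.
have /choice[f fE] x : exists l, forall n,
    rnorm (sqrt_iter G n x - l) <= q / (1 - q) * rnorm x * q ^+ n.
  have [l ul] := geometric_limit q01 (fun n => sqrt_iter_step n x).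
  by exists l => n; rewrite (mulrAC q).
have [|X XE] := @linear_pack _ _ f; last by exists X => x n; rewrite XE.
move=> a x y.
(* The iterates are linear, so the defect of linearity of [f] is at most the sum of the
   approximation errors at [a *: x + y], at [x] (times |a|) and at [y]. *)
apply: (@eq_geometric _ _ _ (q / (1 - q) * rnorm (a *: x + y) +
  (complex.Re `|a| * (q / (1 - q) * rnorm x) + q / (1 - q) * rnorm y)) _ _ q01) => n.
rewrite -(subrKA (sqrt_iter G n (a *: x + y))) mulrDl.
apply: le_trans (rnormD _ _) (lerD _ _); first by rewrite -rnormN opprB.
rewrite sqrt_iter_linear opprD addrACA -scalerBr mulrDl.
apply: le_trans (rnormD _ _) (lerD _ _) => //.
have -> : rnorm (a *: (sqrt_iter G n x - f x)) =
    complex.Re `|a| * rnorm (sqrt_iter G n x - f x).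
  by apply: complexI; rewrite rmorphM/= RRe_real ?normr_real// -!rnormE normrZ.
rewrite -(mulrA (complex.Re _)) ler_wpM2l//.
by rewrite -lecR RRe_real ?normr_real//; exact: normr_ge0.
Qed.

Definition sqrt_limit (X : {linear H -> H}) := forall x n,
  rnorm (sqrt_iter G n x - X x) <= q / (1 - q) * rnorm x * q ^+ n.

Lemma sqrt_limit_bound X x : sqrt_limit X -> rnorm (X x) <= q * rnorm x.
Proof.
move=> XG; rewrite -subr_le0.
apply: (@le0_geometric _ _ (q / (1 - q) * rnorm x) _ q01) => n.
rewrite lerBlDr; apply: le_trans (lerD (XG x n) (sqrt_iter_bound n x)).
rewrite -[X in rnorm X <= _](subKr (sqrt_iter G n x)).
by rewrite addrC (le_trans (rnormD _ _))// rnormN addrC.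
Qed.

Lemma sqrt_limit_fixpoint X x : sqrt_limit X ->
  X x = (2^-1)%:C%C *: (G x + X (X x)).
Proof.
move=> XG; have /andP[q0 q1] := q01.
set K := q / (1 - q); have K0 : 0 <= K by rewrite divr_ge0// subr_ge0 ltW.
apply: (@eq_geometric _ _ _ (K * rnorm x * q + (q * (K * rnorm x) + K * rnorm (X x)))
  _ _ q01) => n.
rewrite -(subrKA (sqrt_iter G n.+1 x)) mulrDl.
apply: le_trans (rnormD _ _) (lerD _ _).
  by rewrite -rnormN opprB -mulrA -exprS XG.
rewrite /= -scalerBr rnormZ ger0_norm ?invr_ge0//.
rewrite opprD addrACA subrr add0r.
(* With X_n the iterate, X_n X_n x - X X x = X_n(X_n x - X x) + (X_n - X)(X x). *)
rewrite ler_pdivrMl// -(subrKA (sqrt_iter G n (X x))) -sqrt_iterB.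
apply: le_trans (rnormD _ _) _.
apply: le_trans (lerD (sqrt_iter_bound n _) (XG (X x) n)) _.
have := ler_wpM2l q0 (XG x n); rewrite -/K => h.
apply: le_trans (lerD h (lexx _)) _.
rewrite (mulrA q (_ * _)) -mulrDl ler_peMl ?ler1n// mulr_ge0 ?exprn_ge0//.
by rewrite addr_ge0 ?(mulr_ge0 q0)// (mulr_ge0 K0)// rnorm_ge0.
Qed.

End Convergence.

(** Iterates are polynomials in [G], so they inherit the intertwining; boundedness of [L] carries it
    to the limit. *)
Lemma sqrt_limit_intertwine (L G G' X X' : {linear H -> H}) (q M : R) :
    0 <= q < 1 -> sqrt_limit G q X -> sqrt_limit G' q X' ->
    0 <= M -> (forall x, rnorm (L x) <= M * rnorm x) ->
    (forall x, L (G x) = G' (L x)) ->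
  forall x, L (X x) = X' (L x).
Proof.
move=> q01 XG XG' M0 LM LG x.
set K := q / (1 - q).
apply: (@eq_geometric _ _ _ (M * (K * rnorm x) + K * rnorm (L x)) _ _ q01) => n.
rewrite -(subrKA (L (sqrt_iter G n x))) mulrDl.
apply: le_trans (rnormD _ _) (lerD _ _).
  by rewrite -linearB -rnormN -linearN opprB (le_trans (LM _))// -mulrA ler_wpM2l.
by rewrite (sqrt_iter_intertwine _ LG) XG'.
Qed.

Lemma sqrt_limit_symmetric (dot : {dot H for Num.conj}) (G X : {linear H -> H}) (q : R) :
    induces_norm dot -> 0 <= q < 1 -> sqrt_limit G q X ->
    (forall x y, rdot dot (G x) y = rdot dot x (G y)) ->
  forall x y, rdot dot (X x) y = rdot dot x (X y).
Proof.
move=> dn q01 XG Gs.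
have Xs n x y : rdot dot (sqrt_iter G n x) y = rdot dot x (sqrt_iter G n y).
  elim: n x y => [|n IH] x y /=.
    by rewrite -[0](scale0r (0 : H)) (rdotZl _ 0) (rdotZr _ 0) !mul0r.
  by rewrite rdotZl rdotZr rdotDl rdotDr Gs !IH.
set K := q / (1 - q).
(* One inequality is enough: exchanging [x] and [y] gives the other. *)
have le x y : rdot dot (X x) y - rdot dot x (X y) <= 0.
  apply: (@le0_geometric _ _ (K * rnorm x * rnorm y + K * rnorm y * rnorm x) _ q01) => n.
  have -> : rdot dot (X x) y - rdot dot x (X y) =
      rdot dot (- (sqrt_iter G n x - X x)) y + rdot dot (sqrt_iter G n y - X y) x.
    by rewrite !rdotE Xs (rdotC _ (X y)) (rdotC _ (sqrt_iter G n y)); ring.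
  rewrite mulrDl; apply: lerD; apply: le_trans (rdot_le dn _ _) _;
    rewrite ?rnormN [leRHS]mulrAC; apply: ler_wpM2r; rewrite ?rnorm_ge0//;
    exact: XG.
move=> x y; have := le x y; have := le y x.
rewrite !subr_le0 (rdotC _ (X y)) (rdotC _ y) => h1 h2.
by apply/eqP; rewrite eq_le h1 h2.
Qed.

End SquareRoot.

(** * The polar factor of a bounded involution *)

Section PolarSymmetry.
Context {R : realType} {H : completeNormedModType R[i]}.
Variable dot : {dot H for Num.conj}.
Hypothesis dot_norm : induces_norm dot.
Implicit Types (x y z : H) (S T : {linear H -> H}).

Definition self_adjoint T := forall x y, rdot dot (T x) y = rdot dot x (T y).

(** Used with [T] adjoint to [S] and both bounded by [s]: dividing by s^2 brings [S T] below the
    identity, where the iteration applies. *)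
Definition gram_gap (s : R) S T : {linear H -> H} :=
  idfun \- ((s ^- 2)%:C%C \*: (S \o T)).

Lemma gram_gapE s S T x : gram_gap s S T x = x - (s ^- 2)%:C%C *: S (T x).
Proof. by []. Qed.

(* Equal to sqrt (S T) when X = 1 - sqrt (1 - gram_gap s S T). *)
Definition root_of_gap (s : R) (X : {linear H -> H}) : {linear H -> H} :=
  s%:C%C \*: (idfun \- X).

Section GramRoot.
Variables (S T : {linear H -> H}) (s : R).
Hypotheses (s1 : 1 <= s) (adj : forall x y, rdot dot (S x) y = rdot dot x (T y)).
Hypotheses (TT : forall x, T (T x) = x) (Ts : forall x, rnorm (T x) <= s * rnorm x).

Let q := 1 - s ^- 2.

Let s0 : 0 < s. Proof. exact: lt_le_trans s1. Qed.

Let sN2_gt0 : 0 < s ^- 2. Proof. by rewrite invr_gt0 exprn_gt0. Qed.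

Let ssN2 : s ^+ 2 * s ^- 2 = 1.
Proof. by rewrite mulfV// expf_neq0// gt_eqF. Qed.

Lemma gap_rate : 0 <= q < 1.
Proof.
rewrite /q subr_ge0 gtrBl sN2_gt0 andbT invf_le1 ?exprn_gt0//.
exact: exprn_ege1.
Qed.

Lemma gram_gap_symmetric : self_adjoint (gram_gap s S T).
Proof.
move=> x y; rewrite !gram_gapE !rdotE adj; congr (_ - _ * _).
by rewrite (rdotC _ x) adj rdotC.
Qed.

(** The form of the gap at x is |x|^2 - s^-2 |Tx|^2. It lies between 0 and (1 - s^-4)|x|^2, since
    |Tx| <= s|x| and |x| = |TTx| <= s|Tx|; and 1 - s^-4 = 2q - q^2. *)
Lemma gram_gap_bound x :
  rnorm (gram_gap s S T x) <= (2 * q - q ^+ 2) * rnorm x.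
Proof.
have /andP[q0 q1] := gap_rate.
apply: (symmetric_form_bound dot_norm) => [||{}x].
- nra.
- exact: gram_gap_symmetric.
rewrite gram_gapE !rdotE adj !rdotxx// ger0_norm; last first.
  rewrite subr_ge0 -(ler_pM2l (exprn_gt0 2 s0)) mulrA ssN2 mul1r -exprMn.
  by rewrite lerXn2r ?nnegrE ?mulr_ge0 ?rnorm_ge0// ltW.
have : rnorm x ^+ 2 <= s ^+ 2 * rnorm (T x) ^+ 2.
  by rewrite -exprMn lerXn2r ?nnegrE ?mulr_ge0 ?rnorm_ge0 ?(ltW s0)// -{1}[x]TT.
rewrite -ler_pdivrMl ?exprn_gt0// => h.
have := ler_wpM2l (ltW sN2_gt0) h; rewrite /q; lra.
Qed.

Section Limit.
Variable X : {linear H -> H}.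
Hypothesis XG : sqrt_limit (gram_gap s S T) q X.
Let D := root_of_gap s X.

(** The fixed point equation 2X = G + X^2 says (1 - X)^2 = 1 - G, which is [S T] divided by s^2. *)
Lemma gram_root_square x : D (D x) = S (T x).
Proof.
rewrite -[LHS]/(s%:C%C *: (s%:C%C *: (x - X x) - X (s%:C%C *: (x - X x)))).
rewrite linearZ/= -scalerBr (raddfB X).
have := sqrt_limit_fixpoint gap_rate gram_gap_bound x XG.
move/(congr1 (fun y => 2%:C%C *: y)); rewrite scalerA -rmorphM mulfV// scale1r.
rewrite -[2]/(1 + 1) rmorphD scalerDl rmorph1 scale1r gram_gapE => e.
have -> : x - X x - (X x - X (X x)) = (s ^- 2)%:C%C *: S (T x).
  by rewrite opprB addrACA -opprD e (addrAC x (- _)) subKr.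
by rewrite !scalerA -!rmorphM -expr2 ssN2 scale1r.
Qed.

Lemma gram_root_symmetric : self_adjoint D.
Proof.
move=> x y; rewrite /D /root_of_gap/= !rdotE.
by rewrite (sqrt_limit_symmetric dot_norm gap_rate XG gram_gap_symmetric).
Qed.

(** [X] is bounded by [q], so D >= s(1 - q) = 1/s. *)
Lemma gram_root_lower x : s^-1 * rnorm x ^+ 2 <= rdot dot (D x) x.
Proof.
rewrite /D /root_of_gap/= !rdotE rdotxx//.
have := le_trans (rdot_le dot_norm (X x) x)
  (ler_wpM2r (rnorm_ge0 x) (sqrt_limit_bound gap_rate gram_gap_bound x XG)).
rewrite -mulrA -expr2 => h.
rewrite -(ler_pM2l s0) !mulrA mulfV ?gt_eqF// mul1r -expr2.
have h2 := ler_wpM2l (ltW (exprn_gt0 2 s0)) h.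
rewrite /q mulrA mulrBr ssN2 mulr1 mulrBl mul1r in h2.
by rewrite mulrBr; lra.
Qed.

(** In fact |Dx| = |Tx|, because D is symmetric with square [S T]. *)
Lemma gram_root_upper x : rnorm (D x) <= s * rnorm x.
Proof.
apply: le_trans (Ts x).
rewrite -(ler_pXn2r (n := 2))// ?nnegrE ?rnorm_ge0// -!(rdotxx dot_norm).
by rewrite gram_root_symmetric gram_root_square rdotC adj.
Qed.

Lemma gram_root_dist x : rnorm (D x - x) <= (s - 1) * rnorm x.
Proof.
have s10 : 0 <= s - 1 by rewrite subr_ge0.
apply: (symmetric_form_bound dot_norm (T := D \- idfun)) => // [{}x y|{}x] /=.
  by rewrite rdotDl rdotDr rdotNl rdotNr gram_root_symmetric.
rewrite rdotDl rdotNl rdotxx//.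
have h1 := gram_root_lower x.
have h2 := le_trans (rdot_le dot_norm (D x) x)
  (ler_wpM2r (rnorm_ge0 x) (gram_root_upper x)).
have n0 := sqr_ge0 (rnorm x).
(* s + 1/s >= 2, so the lower bound 1/s - 1 on D - 1 is at least -(s - 1). *)
have : (2 - s) * rnorm x ^+ 2 <= s^-1 * rnorm x ^+ 2.
  rewrite ler_wpM2r// -(ler_pM2l s0) mulfV ?gt_eqF//.
  by have := sqr_ge0 (s - 1); nra.
rewrite -mulrA -expr2 in h2.
by rewrite ler_norml => h3; apply/andP; split; lra.
Qed.

End Limit.
End GramRoot.

(** [S T] and [T S] are inverse to each other. *)
Lemma gram_gap_commute (s : R) S T x :
    (forall x, S (S x) = x) -> (forall x, T (T x) = x) ->
  gram_gap s S T (gram_gap s T S x) = gram_gap s T S (gram_gap s S T x).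
Proof.
move=> SS TT; rewrite !gram_gapE.
rewrite (linearB T) (linearB S) (linearZZ T) (linearZZ S) TT SS.
rewrite (linearB S) (linearB T) (linearZZ S) (linearZZ T) SS TT.
rewrite !scalerBr !opprB !addrA addrAC [RHS]addrAC.
by congr (_ + _); rewrite addrAC.
Qed.

(* The roots D of S T and E of T S = (S T)^-1 commute because the gaps do, so
   D E is a self-adjoint involution; y = x - D E x satisfies E (D y) = - y,
   which positivity of D and E only allows for y = 0. *)
Lemma gram_roots_mulC (s : R) S T (X Y : {linear H -> H}) :
    1 <= s -> (forall x y, rdot dot (S x) y = rdot dot x (T y)) ->
    (forall x, S (S x) = x) -> (forall x, T (T x) = x) ->
    (forall x, rnorm (S x) <= s * rnorm x) ->
    (forall x, rnorm (T x) <= s * rnorm x) ->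
    sqrt_limit (gram_gap s S T) (1 - s ^- 2) X ->
    sqrt_limit (gram_gap s T S) (1 - s ^- 2) Y ->
  forall x, root_of_gap s X (root_of_gap s Y x) = x.
Proof.
move=> s1 adj SS TT Ss Ts XG YG.
have adj' x y : rdot dot (T x) y = rdot dot x (S y) by rewrite rdotC -adj rdotC.
have q01 := gap_rate s1; have /andP[q0 q1] := q01.
set D := root_of_gap s X; set E := root_of_gap s Y.
(* Intertwining twice: the gap of [T S] commutes with that of [S T], hence with [X]; then [X]
   commutes with [Y]. *)
have XY x : X (Y x) = Y (X x).
  apply: (sqrt_limit_intertwine q01 YG YG q0) => {}x.
    exact: (sqrt_limit_bound q01 (gram_gap_bound s1 adj TT Ts) x XG).
  apply/esym; move: x; apply: (sqrt_limit_intertwine q01 XG XG _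
    (gram_gap_bound s1 adj' SS Ss)) => [|x].
    by nra.
  by rewrite gram_gap_commute.
have DE x : D (E x) = E (D x).
  rewrite -[LHS]/(s%:C%C *: (s%:C%C *: (x - Y x) - X (s%:C%C *: (x - Y x)))).
  rewrite -[RHS]/(s%:C%C *: (s%:C%C *: (x - X x) - Y (s%:C%C *: (x - X x)))).
  rewrite (linearZZ X) (linearZZ Y) -!scalerBr (linearB X) (linearB Y) XY; do 2!congr (_ *: _).
  by rewrite !opprB !addrA addrAC [RHS]addrAC; congr (_ + _); rewrite addrAC.
have DD x : D (D x) = S (T x) := gram_root_square s1 adj TT Ts XG x.
have EE x : E (E x) = T (S x) := gram_root_square s1 adj' SS Ss YG x.
move=> x; pose y := x - D (E x).
have yE : E (D y) = - y.
  by rewrite /y (linearB D) (linearB E) -(DE x) -(DE (D (E x))) -(DE (E x)) DD EE TT SS opprB.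
have lowE := gram_root_lower s1 adj' SS Ss YG (D y).
have lowD := gram_root_lower s1 adj TT Ts XG y.
rewrite -/E yE rdotNl (rdotC dot y) in lowE; rewrite -/D in lowD.
have s0 : 0 < s^-1 by rewrite invr_gt0 (lt_le_trans _ s1).
have n1 := mulr_ge0 (ltW s0) (sqr_ge0 (rnorm (D y))).
have : s^-1 * rnorm y ^+ 2 <= 0 by lra.
rewrite pmulr_rle0// => n2.
have : rnorm y ^+ 2 == 0 by rewrite eq_le n2 sqr_ge0.
rewrite sqrf_eq0 => /eqP n0.
by apply/esym/eqP; rewrite -subr_eq0; apply/eqP/rnorm_le0; rewrite -/y n0.
Qed.

(* U = S sqrt (S S^* ) is the polar factor, because (S^* S)^-1 = S S^*; hence
   no inverse has to be constructed. *)
Lemma polar_symmetry S (s : R) : 1 <= s -> (forall x, S (S x) = x) ->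
    (forall x, rnorm (S x) <= s * rnorm x) ->
  exists U : {linear H -> H}, [/\ self_adjoint U, forall x, U (U x) = x &
    forall x, rnorm (U x - S x) <= (s - 1) * rnorm x].
Proof.
move=> s1 SS Ss.
have s0 : 0 <= s by rewrite (le_trans _ s1).
have [T adj] := adjoint_ex dot_norm Ss.
have Ts := adjoint_bound dot_norm s0 Ss adj.
have TT x : T (T x) = x by apply: (rdot_ext dot_norm) => z; rewrite -!adj SS.
have adj' x y : rdot dot (T x) y = rdot dot x (S y) by rewrite rdotC -adj rdotC.
have q01 := gap_rate s1.
have [X XG] := sqrt_iter_lim q01 (gram_gap_bound s1 adj TT Ts).
have [Y YG] := sqrt_iter_lim q01 (gram_gap_bound s1 adj' SS Ss).
have DE := gram_roots_mulC s1 adj SS TT Ss Ts XG YG.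
have DD := gram_root_square s1 adj TT Ts XG.
have Ds := gram_root_symmetric s1 adj XG.
have Dd := gram_root_dist s1 adj TT Ts XG.
(* S(ST) = T = (TS)S, so [S] carries one gap, and its limit, to the other. This yields SD = ES and
   then DSD = DES = S. *)
have SX : forall x, S (X x) = Y (S x).
  apply: (sqrt_limit_intertwine q01 XG YG s0 Ss) => x.
  by rewrite !gram_gapE (linearB S) (linearZZ S) !SS.
have SD x : S (root_of_gap s X x) = root_of_gap s Y (S x).
  by rewrite -[LHS]/(S (s%:C%C *: (x - X x))) (linearZZ S) (linearB S) SX.
move: (root_of_gap s X) (root_of_gap s Y) DE DD Ds Dd SD.
move=> D E DE DD Ds Dd SD.
have DSD x : D (S (D x)) = S x by rewrite SD DE.
(* The adjoint of SD is DT, and T = S(ST) = SDD gives DT = (DSD)D = SD. *)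
have Us : self_adjoint (S \o D).
  by move=> x y /=; rewrite adj Ds -[T y]SS -DD DSD.
exists (S \o D); split=> // x /=; first by rewrite DSD SS.
have Ux : rnorm (S (D x)) = rnorm x.
  apply/eqP; rewrite -(eqrXn2 (n := 2))// ?rnorm_ge0// -!(rdotxx dot_norm).
  by have /= -> := Us x (S (D x)); rewrite DSD SS.
(* S = DU, so Ux - Sx = (1 - D)(Ux), and [U] is isometric. *)
by rewrite -(DSD x) -Ux -rnormN opprB Dd.
Qed.

End PolarSymmetry.

(** * Operator norms, projections and self-adjoint involutions *)

Section OperatorNorm.
Context {R : realType} {H : completeNormedModType R[i]}.
Variable dot : {dot H for Num.conj}.
Hypothesis dot_norm : induces_norm dot.
Implicit Types (x y z : H) (P Q S T : {linear H -> H}).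

Lemma bounded_operatorP T : bounded_operator T <->
  exists M : R, forall x, rnorm (T x) <= M * rnorm x.
Proof.
rewrite /bounded_operator linear_boundedP; split.
  move=> /pinfty_ex_gt0[M M0 TM]; exists (complex.Re M) => x.
  by rewrite -lecR rmorphM/= -!rnormE RRe_real ?gtr0_real.
move=> [M TM]; exists M%:C%C; split; first by rewrite complex_real.
move=> r Mr x; apply: (@le_trans _ _ (M%:C%C * `|x|)).
  by rewrite !rnormE -rmorphM lecR.
by rewrite ler_wpM2r// ltW.
Qed.

Lemma le_opnorm T x : bounded_operator T -> rnorm (T x) <= opnorm T * rnorm x.
Proof.
move=> /bounded_operatorP[M TM].
have [->|x0] := eqVneq x 0; first by rewrite linear0 rnorm0 mulr0.
have nx := rnorm_gt0 x0.
rewrite -ler_pdivrMr//; apply: ub_le_sup.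
  exists `|M| => _ [y /=  y1 <-]; apply: le_trans (TM y) _.
  rewrite rnormE -[1]/(1%:C%C) lecR in y1.
  apply: le_trans (ler_wpM2r (rnorm_ge0 _) (ler_norm M)) _.
  by rewrite ler_piMr.
exists (((rnorm x)^-1)%:C%C *: x) => /=.
  rewrite rnormE rnormZ ger0_norm ?invr_ge0 ?rnorm_ge0//.
  by rewrite mulVf ?gt_eqF// lecR.
rewrite linearZ/= -/(rnorm _) rnormZ ger0_norm ?invr_ge0 ?rnorm_ge0//.
by rewrite mulrC.
Qed.

Lemma opnorm_le T (M : R) : 0 <= M -> (forall x, rnorm (T x) <= M * rnorm x) ->
  opnorm T <= M.
Proof.
move=> M0 TM; apply: ge_sup.
  by exists (rnorm (T 0)), 0 => //=; rewrite normr0.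
move=> _ [y /= y1 <-]; apply: le_trans (TM y) _.
rewrite rnormE -[1]/(1%:C%C) lecR in y1.
by rewrite ler_piMr.
Qed.

Lemma opnorm_ge0 T : bounded_operator T -> (exists x : H, x != 0) -> 0 <= opnorm T.
Proof.
move=> Tb [x x0]; have := le_trans (rnorm_ge0 _) (le_opnorm x Tb).
by rewrite pmulr_lge0// rnorm_gt0.
Qed.

Lemma projection_rdot P x y : projection dot P ->
  rdot dot (P x) y = rdot dot x (P y).
Proof. by move=> [_ Ps]; rewrite /rdot Ps. Qed.

Lemma projection_rdotP P x y : projection dot P ->
  rdot dot (P x) (P y) = rdot dot (P x) y.
Proof.
move=> Pp; have [[_ PP] _] := Pp.
by rewrite -projection_rdot//; have /= -> := PP x.
Qed.

(* (P - P')^2 + (1 - P - P')^2 = 1 for any two projections *)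
Lemma projectionB_bound P P' x : projection dot P -> projection dot P' ->
  rnorm (P x - P' x) <= rnorm x.
Proof.
move=> Pp Pp'.
rewrite -(ler_pXn2r (n := 2))// ?nnegrE ?rnorm_ge0// -!(rdotxx dot_norm).
have := sqr_ge0 (rnorm (x - P x - P' x)); rewrite -(rdotxx dot_norm) !rdotE.
rewrite !(projection_rdotP _ _ Pp) !(projection_rdotP _ _ Pp').
rewrite (rdotC _ x (P x)) (rdotC _ x (P' x)) (rdotC _ (P' x) (P x)); lra.
Qed.

Lemma projection_reflection P x : projection dot P ->
  rnorm (x - P x - P x) = rnorm x.
Proof.
move=> Pp.
apply/eqP; rewrite -(eqrXn2 (n := 2))// ?rnorm_ge0// -!(rdotxx dot_norm).
rewrite !rdotE !(projection_rdotP _ _ Pp) (rdotC _ x (P x)); apply/eqP; ring.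
Qed.

Lemma half_double x : (2^-1)%:C%C *: (x + x) = x.
Proof.
have half1 : 2^-1 + 2^-1 = 1 :> R by field.
by rewrite scalerDr -scalerDl -rmorphD/= half1 scale1r.
Qed.

Lemma symmetry_projection U : self_adjoint dot U -> (forall x, U (U x) = x) ->
  exists P, projection dot P /\ forall x, P x = (2^-1)%:C%C *: (x + U x).
Proof.
move=> Us UU.
pose P : {linear H -> H} := (2^-1)%:C%C \*: (idfun \+ U).
exists P; split=> //.
have PE x : P x = (2^-1)%:C%C *: (x + U x) by [].
have UP x : U (P x) = P x by rewrite !PE (linearZZ U) (linearD U) UU addrC.
have PP x : P (P x) = P x.
  by rewrite (PE (P x)) UP half_double.
have Ps x y : rdot dot (P x) y = rdot dot x (P y).
  by rewrite !PE !rdotE Us.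
split; first split=> //.
  apply/bounded_operatorP; exists 1 => x; rewrite mul1r.
  have [->|Px0] := eqVneq (P x) 0; first by rewrite rnorm0 rnorm_ge0.
  rewrite -(ler_pM2l (rnorm_gt0 Px0)) -expr2 -(rdotxx dot_norm) Ps PP -Ps.
  exact: rdot_le.
move=> x y.
(* Evaluating at [x] and at i x kills the real and the imaginary part of the defect. *)
have Re0 z : complex.Re (dot (P z) y - dot z (P y)) = 0.
  by rewrite raddfB; apply/eqP; rewrite subr_eq0; apply/eqP/Ps.
have := Re0 ('i%C *: x); have := Re0 x.
rewrite (linearZZ P) !linearZl_LR/= -mulrBr => r0 i0.
apply/eqP; rewrite -subr_eq0; move: r0 i0; case: (_ - _) => a b /= -> .
by rewrite !mul0r mul1r add0r => /eqP; rewrite oppr_eq0 => /eqP ->.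
Qed.

End OperatorNorm.

(** * Extremal distances from an idempotent to the projections *)

Theorem theorem2p4 (R : realType) (H : completeNormedModType R[i])
    (dot : {dot H for Num.conj}) (dot_norm : induces_norm dot)
    (H_neq0 : exists x : H, x != 0)
    (Q : {linear H -> H}) (Q_idem : idempotent_operator Q)
    (P0 : {linear H -> H}) (P0_proj : projection dot P0)
    (P0_min : forall P : {linear H -> H}, projection dot P ->
                opnorm (P0 \- Q) <= opnorm (P \- Q)) :
  opnorm (idfun \- P0 \- Q) = 1 + opnorm (P0 \- Q) /\
  (forall P : {linear H -> H}, projection dot P ->
     opnorm (P \- Q) <= opnorm (idfun \- P0 \- Q)).
Proof.
have [Qb QQ] := Q_idem.
have bounded_sub (S T : {linear H -> H}) : bounded_operator S ->
    bounded_operator T -> bounded_operator (S \- T).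
  move=> /bounded_operatorP[M SM] /bounded_operatorP[N TN].
  apply/bounded_operatorP; exists (M + N) => x /=.
  by rewrite mulrDl (le_trans (rnormD _ _))// rnormN lerD.
have id_bounded : bounded_operator (idfun : {linear H -> H}).
  by apply/bounded_operatorP; exists 1 => x; rewrite mul1r.
have proj_bounded (P : {linear H -> H}) : projection dot P -> bounded_operator P.
  by move=> [[]].
have P0Q := bounded_sub _ _ (proj_bounded _ P0_proj) Qb.
have P0Q' := bounded_sub _ _ (bounded_sub _ _ id_bounded (proj_bounded _ P0_proj)) Qb.
have d0 := opnorm_ge0 P0Q H_neq0.
pose S : {linear H -> H} := (Q \- idfun) \+ Q.
have SE x : S x = Q x - x + Q x by [].
have Sb : bounded_operator S.
  have /bounded_operatorP[M QM] := Qb; apply/bounded_operatorP.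
  exists (M + 1 + M) => x; rewrite SE !mulrDl mul1r.
  rewrite (le_trans (rnormD _ _))// lerD//.
  by rewrite (le_trans (rnormD _ _))// rnormN lerD.
have SS x : S (S x) = x.
  have QS : Q (S x) = Q x.
    by rewrite SE (linearD Q) (linearB Q); have /= -> := QQ x; rewrite subrr add0r.
  by rewrite SE QS SE opprD opprB addrA subrK addrC subrK.
have Snorm x := le_opnorm x Sb.
have s0 := opnorm_ge0 Sb H_neq0.
(* |x| = |SSx| <= |S|^2 |x| at a non-zero vector. *)
have s1 : 1 <= opnorm S.
  have [x x0] := H_neq0; have nx := rnorm_gt0 x0.
  have := le_trans (Snorm (S x)) (ler_wpM2l s0 (Snorm x)).
  rewrite SS mulrA -{1}[rnorm x]mul1r ler_pM2r// -expr2.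
  by rewrite -{1}(expr1n _ 2) ler_pXn2r ?nnegrE.
(* Minimality of [P0] is compared with P = (1 + U) / 2, for which P - Q = (U - S) / 2. *)
have dS : 1 + 2 * opnorm (P0 \- Q) <= opnorm S.
  have [U [Us UU USd]] := polar_symmetry dot_norm s1 SS Snorm.
  have [P [Pp PE]] := symmetry_projection dot_norm Us UU.
  have : opnorm (P \- Q) <= (opnorm S - 1) / 2.
    apply: opnorm_le => [|x /=]; first by rewrite divr_ge0// subr_ge0.
    have -> : P x - Q x = (2^-1)%:C%C *: (U x - S x).
      rewrite PE SE; rewrite -[Q x in LHS]half_double -scalerBr; congr (_ *: _).
      by rewrite !opprD opprK !addrA (addrC x) (addrAC (U x) x).
    rewrite rnormZ ger0_norm ?invr_ge0//.
    by rewrite ler_pdivrMl// mulrA mulrCA mulfV// mulr1.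
  by have := P0_min P Pp; lra.
have upper : opnorm (idfun \- P0 \- Q) <= 1 + opnorm (P0 \- Q).
  apply: opnorm_le => [|x /=]; first by rewrite addr_ge0.
  have -> : x - P0 x - Q x = (x - P0 x - P0 x) + (P0 x - Q x).
    by rewrite addrA subrK.
  rewrite (le_trans (rnormD _ _))// mulrDl mul1r lerD ?(projection_reflection dot_norm)//.
  exact: (le_opnorm x P0Q).
have eqn : opnorm (idfun \- P0 \- Q) = 1 + opnorm (P0 \- Q).
  apply/eqP; rewrite eq_le upper/=.
  have : opnorm S <= opnorm (idfun \- P0 \- Q) + opnorm (P0 \- Q).
    apply: opnorm_le => [|x /=]; first by rewrite addr_ge0 ?(opnorm_ge0 P0Q').
    (* The two occurrences of [P0] cancel, leaving a lower bound for |I - P0 - Q| in terms of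
       |S|. *)
    have -> : Q x - x + Q x = - ((x - P0 x - Q x) + (P0 x - Q x)).
      by rewrite addrA (addrAC (x - P0 x)) subrK !opprB addrC.
    rewrite rnormN (le_trans (rnormD _ _))// mulrDl lerD//.
      exact: (le_opnorm x P0Q').
    exact: (le_opnorm x P0Q).
  by lra.
split=> // P Pp; rewrite eqn.
apply: opnorm_le => [|x /=]; first by rewrite addr_ge0.
rewrite -(subrKA (P0 x)) (le_trans (rnormD _ _))// mulrDl mul1r lerD//.
  exact: (projectionB_bound dot_norm).
exact: (le_opnorm x P0Q).
Qed.
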